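(* Let $G=(E,V)$ be a locally finite (unoriented, weighted, loopless) graph with degree function $d=d_G$. Put $E(x):=\max_{y\sim x}E(x,y)$ for $x\in V$. Suppose that $$\sup_{x}\max_{y\sim x}|d(x)-d(y)|<\infty\quad\text{and}\quad \sup_{x}\max_{y\sim x}|E(x)-E(y)|<\infty .$$ Suppose also that $d$ is bounded on $V$ or that $E(\cdot,\cdot)$ is bounded on $V\times V$. Then the adjacency matrix $\mathcal{A}_G$ is essentially self-adjoint on $\mathcal{C}_c(G)$.
   Context: A graph $G=(E,V)$ consists of a countable set $V$ (vertices) and a symmetric function $E:V\times V\to[0,\infty)$ (weights), $E(x,y)=E(y,x)$, with no loops: $E(x,x)=0$ for all $x\in V$. Write $x\sim y$ ($x,y$ are neighbors) if $E(x,y)\neq 0$. The degree of $x$ is $d_G(x):=|\{y\in V: E(x,y)\ne 0\}|$, and $G$ is locally finite if $d_G(x)<\infty$ for every $x\in V$. The Hilbert space is the complex space $\ell^2(V)$, and $\mathcal{C}_c(G)$ is the set of finitely supported functions $V\to\mathbb{C}$. The adjacency matrix is the operator $(\mathcal{A}_{G,\circ}f)(x):=\sum_{y\sim x}E(x,y)f(y)$ for $f\in\mathcal{C}_c(G)$; it is symmetric, and its closure is denoted $\mathcal{A}_G$. Essential self-adjointness on $\mathcal{C}_c(G)$ means that $\mathcal{A}_G=(\mathcal{A}_G)^*$. Maxima over empty sets of neighbors are taken to be $0$. *)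

(* Defs.v *)
From HB Require Import structures.
From mathcomp Require Import all_boot all_order all_algebra finmap complex.
From mathcomp Require Import all_classical all_reals.
From mathcomp Require Import ereal esum.

Set Implicit Arguments.
Unset Strict Implicit.
Unset Printing Implicit Defensive.
Import Order.TTheory GRing.Theory Num.Theory.

Local Open Scope classical_set_scope.
Local Open Scope ring_scope.

Record wgraph (R : realType) (V : countType) := WGraph {
  weight :> V -> V -> R;
  weight_ge0 : forall x y, 0 <= weight x y;
  weight_sym : forall x y, weight x y = weight y x;
  weight_loopless : forall x, weight x x = 0 }.

Section Graph.
Context {R : realType} {V : countType}.
Implicit Types (G : wgraph R V) (x y : V).

Definition adjacent G x y : bool := G x y != 0.

Definition locally_finite G : Prop :=
  forall x, finite_set [set y | adjacent G x y].

(* [fset_set] is [fset0] on infinite sets: [neighbors], and all that is built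
   on it, is meant for locally finite graphs only. *)
Definition neighbors G x : {fset V} := fset_set [set y | adjacent G x y].

Definition degree G x : nat := #|` neighbors G x|.

(* For nonnegative [F], the maximum of [F] over the neighbors of [x], and [0]
   if there are none. *)
Definition max_neighbors G x (F : V -> R) : R :=
  \big[Num.max/0]_(y <- neighbors G x) F y.

Definition max_weight G x : R := max_neighbors G x (G x).

(* sup_x max_{y ~ x} |h x - h y| *)
Definition sup_variation G (h : V -> R) : \bar R :=
  ereal_sup [set (max_neighbors G x (fun y => `|h x - h y|))%:E | x in [set: V]].

Definition adjacency G (f : V -> R[i]) : V -> R[i] :=
  fun x => \sum_(y <- neighbors G x) (G x y)%:C%C * f y.

End Graph.

Section SquareSummable.
Context {R : realType} {V : countType}.
Implicit Types f g : V -> R[i].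

Definition finitely_supported : set (V -> R[i]) :=
  [set f | finite_set [set x | f x != 0]].

Definition sqnorm f : \bar R := \esum_(x in [set: V]) (Normc.normc (f x) ^+ 2)%:E.

Definition ell2 : set (V -> R[i]) := [set f | (sqnorm f < +oo)%E].

(* Unordered sums of absolutely summable families; junk otherwise. *)
Definition rsum (u : V -> R) : R :=
  fine (\esum_(x in [set: V]) (Num.max (u x) 0)%:E) -
  fine (\esum_(x in [set: V]) (Num.max (- u x) 0)%:E).

Definition csum f : R[i] :=
  Complex (rsum (fun x => complex.Re (f x))) (rsum (fun x => complex.Im (f x))).

Definition inner f g : R[i] := csum (fun x => f x * conjc (g x)).

End SquareSummable.

(* An unbounded operator in ell2 is represented by its graph, i.e. by the set
   of the pairs (f, T f) for f in its domain. *)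
Section Operators.
Context {R : realType} {V : countType}.
Implicit Types T : set ((V -> R[i]) * (V -> R[i])).

Definition operator_on (D : set (V -> R[i])) (A : (V -> R[i]) -> V -> R[i]) :
  set ((V -> R[i]) * (V -> R[i])) := [set (f, A f) | f in D].

Definition op_closure T : set ((V -> R[i]) * (V -> R[i])) :=
  [set p | [/\ ell2 p.1, ell2 p.2 &
     forall e : R, 0 < e -> exists2 q, T q &
       (sqnorm (p.1 \- q.1)%R < (e ^+ 2)%:E)%E /\
       (sqnorm (p.2 \- q.2)%R < (e ^+ 2)%:E)%E]].

(* (g, h) is in the adjoint iff <T f, g> = <f, h> for all f in the domain of
   T; for a densely defined T this is the graph of the usual adjoint. *)
Definition op_adjoint T : set ((V -> R[i]) * (V -> R[i])) :=
  [set p | [/\ ell2 p.1, ell2 p.2 &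
     forall q, T q -> inner q.2 p.1 = inner q.1 p.2]].

Definition self_adjoint T : Prop := T = op_adjoint T.

Definition essentially_self_adjoint T : Prop := self_adjoint (op_closure T).

End Operators.

Definition adjacency_op {R : realType} {V : countType} (G : wgraph R V) :=
  operator_on finitely_supported (adjacency G).

(* Main.v *)
Require Import Defs.
From mathcomp Require Import all_boot all_order all_algebra finmap complex.
From mathcomp Require Import ring lra.
From mathcomp Require Import all_classical all_reals.
From mathcomp Require Import ereal esum.

(** The closure of the adjacency matrix on finitely supported functions is the
maximal operator, whose graph consists of the pairs (g, A g) with both g and the
pointwise defined A g square summable.  Testing against point masses shows that
every adjoint of an extension of the adjacency matrix lies in the maximal
operator, and pointwise convergence shows the same for the closure.  So
everything reduces to a core property, [adjacency_core]: every pair (g, A g) of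
the maximal operator is a limit of pairs (f, A f) with f finitely supported.
Symmetry of the closure then follows by continuity of the inner product, and
[essentially_self_adjoint_of_core] assembles these facts.

The core property uses the hypotheses only through a potential L on the vertices
that dominates the row sums of the weights and varies by at most a constant C
along each edge.  If the degree is bounded by M, take L = M E(.); if the weights
are bounded by M, take L = M d.

Given L, let chi_n be a cutoff equal to 1 where L <= n, equal to 0 where
L >= 2 n, and Lipschitz in L with constant 1/n.  The commutator of A with chi_n
has the kernel E(x, y) (chi_n(y) - chi_n(x)), where the second factor is at most
C/n and vanishes where L(x) > 2 n + C; its row sums are hence at most
(2 n + C) C / n <= 3 C for n >= C, and by the Schur test its norm is bounded
uniformly in n.  It also kills functions supported in a fixed finite set K once
n is large, so it tends strongly to 0, and A (chi_n g) tends to A g.  The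
sublevel sets of L may be infinite, but A is bounded on functions supported in
one of them, again by the Schur test, so chi_n g can finally be truncated to a
finite set F, chosen after n. *)

Set Implicit Arguments.
Unset Strict Implicit.
Unset Printing Implicit Defensive.
Import Order.TTheory GRing.Theory Num.Theory.
Import Normc.
Local Open Scope classical_set_scope.
Local Open Scope ring_scope.

Local Notation sumV a := (\esum_(x in [set: _]) (a x)%:E).

(** * Unordered sums of nonnegative families *)

Section Sums.
Context {R : realType} {V : choiceType}.
Implicit Types (a b : V -> R) (F K : {fset V}).

Lemma ler_sum_fsubset a F K : (forall x, 0 <= a x) -> (F `<=` K)%fset ->
  \sum_(x <- F) a x <= \sum_(x <- K) a x.
Proof.
move=> a0 FK; rewrite (big_fsetID _ (mem F) K)/=.
rewrite (_ : [fset x in K | x \in F]%fset = F); first by rewrite lerDl sumr_ge0.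
apply/fsetP=> x; rewrite !inE/= andbC; apply: andb_idr.
exact: (fsubsetP FK).
Qed.

Lemma fset_sum_le_sumV a F : (forall x, 0 <= a x) ->
  ((\sum_(x <- F) a x)%:E <= sumV a)%E.
Proof.
move=> a0; apply: esum_ge; exists [set` F]; first by split=> //; exact: finite_fset.
by rewrite -sumEFin fsbig_finite ?set_fsetK //; exact: finite_fset.
Qed.

Lemma sumV_le_ub a (c : \bar R) :
  (forall F, ((\sum_(x <- F) a x)%:E <= c)%E) -> (sumV a <= c)%E.
Proof.
move=> ac; apply: ge_ereal_sup => _ [X [finX _] <-].
by rewrite fsbig_finite // sumEFin; exact: ac.
Qed.

Lemma sumV_ge0 a : (forall x, 0 <= a x) -> (0 <= sumV a)%E.
Proof. by move=> a0; apply: esum_ge0 => x _; rewrite lee_fin. Qed.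

Lemma le_sumV a b : (forall x, a x <= b x) -> (sumV a <= sumV b)%E.
Proof. by move=> ab; apply: le_esum => x _; rewrite lee_fin. Qed.

Lemma sumVD a b : (forall x, 0 <= a x) -> (forall x, 0 <= b x) ->
  sumV (a \+ b) = (sumV a + sumV b)%E.
Proof. by move=> a0 b0; rewrite -esumD// => x _; rewrite lee_fin. Qed.

Lemma sumVZ_le (c : R) a : 0 <= c -> (forall x, 0 <= a x) ->
  (sumV (fun x => c * a x) <= c%:E * sumV a)%E.
Proof.
move=> c0 a0; apply: sumV_le_ub => F; rewrite -mulr_sumr EFinM.
by apply: lee_wpmul2l; rewrite ?lee_fin//; exact: fset_sum_le_sumV.
Qed.

Lemma sumV_fsupp a F : (forall x, 0 <= a x) -> (forall x, x \notin F -> a x = 0) ->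
  sumV a = (\sum_(x <- F) a x)%:E.
Proof.
move=> a0 aF; apply/eqP; rewrite eq_le fset_sum_le_sumV// andbT.
apply: sumV_le_ub => K; rewrite lee_fin.
rewrite [leRHS](big_fset_incl _ (fsubsetUr K F)); last by move=> x _ /aF.
by apply: ler_sum_fsubset => //; exact: fsubsetUl.
Qed.

Lemma sumV_tail a (d : R) : (forall x, 0 <= a x) -> (sumV a < +oo)%E -> 0 < d ->
  exists K, (sumV (fun x => if x \in K then 0 else a x) < d%:E)%E.
Proof.
move=> a0 aoo d0.
have afin : sumV a \is a fin_num by rewrite ge0_fin_numE// sumV_ge0.
have [_ [X [finX _] <-]] := ub_ereal_sup_adherent d0 afin.
rewrite fsbig_finite // sumEFin -/(sumV a); set K := fset_set X => aK.
exists K; move: aK.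
pose b x := if x \in K then a x else 0.
pose c x := if x \in K then 0 else a x.
have ->: sumV a = (sumV b + sumV c)%E.
  rewrite -sumVD => [|x|x]; rewrite /b /c; try by case: ifP.
  by apply: eq_esum => x _ /=; case: ifP; rewrite ?addr0 ?add0r.
rewrite (@sumV_fsupp b K); last 2 first.
- by rewrite /b => x; case: ifP.
- by rewrite /b => x /negbTE ->.
rewrite (_ : \sum_(x <- K) b x = \sum_(x <- K) a x); last first.
  by apply: eq_big_seq => x xK; rewrite /b xK.
have : (0 <= sumV c)%E by apply: sumV_ge0 => x; rewrite /c; case: ifP.
case: (sumV c) => [r| |]; rewrite //= -!EFinD !lte_fin => _; lra.
Qed.

Lemma sumV_lt_pinfty_fin a : (forall x, 0 <= a x) -> (sumV a < +oo)%E ->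
  exists2 r : R, 0 <= r & sumV a = r%:E.
Proof.
move=> a0; have := sumV_ge0 a0; case: (sumV a) => [r| |] //.
by rewrite lee_fin; exists r.
Qed.

End Sums.

(** * The Schur test *)

Section Schur.
Context {R : realType} {V : choiceType}.

(** The variance of [u] about its mean under the weights [k] is nonnegative; an
upper bound [b] on the total mass may replace the mass itself. *)
Lemma weighted_cauchy_schwarz (s : seq V) (k u : V -> R) (b : R) : 0 < b ->
  (forall y, 0 <= k y) -> \sum_(y <- s) k y <= b ->
  (\sum_(y <- s) k y * u y) ^+ 2 <= b * \sum_(y <- s) k y * u y ^+ 2.
Proof.
move=> b0 k0 kb; set P := \sum_(y <- s) k y * u y; set Q := \sum_(y <- s) _.
pose t := P / b.
have : 0 <= \sum_(y <- s) k y * (u y - t) ^+ 2.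
  by apply: sumr_ge0 => y _; rewrite mulr_ge0// sqr_ge0.
have -> : \sum_(y <- s) k y * (u y - t) ^+ 2 =
    Q - 2 * t * P + t ^+ 2 * \sum_(y <- s) k y.
  rewrite /Q /P !mulr_sumr -sumrB -big_split/=; apply: eq_bigr => y _; ring.
have : t ^+ 2 * \sum_(y <- s) k y <= t ^+ 2 * b by rewrite ler_wpM2l// sqr_ge0.
have Pt : P = b * t by rewrite /t mulrC divfK// gt_eqF.
rewrite Pt => h1 h2.
have h3 : b * t ^+ 2 <= Q by nra.
have -> : (b * t) ^+ 2 = b * (b * t ^+ 2) by ring.
by rewrite ler_pM2l.
Qed.

(** A symmetric kernel whose row sums are at most [b] defines an operator of norm
at most [b].  It suffices to bound the sum over a finite set [F] of rows, which
involves only the columns in the finite union [U] of the supports of these rows: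
the Cauchy-Schwarz inequality in each row leaves a double sum, and exchanging
the summations turns it into column sums, equal to row sums by symmetry. *)
Lemma schur_test (N : V -> {fset V}) (k : V -> V -> R) (b : R) (u : V -> R) :
  0 < b -> (forall x y, 0 <= k x y) -> (forall x y, k x y = k y x) ->
  (forall x y, y \notin N x -> k x y = 0) ->
  (forall x, \sum_(y <- N x) k x y <= b) ->
  (sumV (fun x => (\sum_(y <- N x) k x y * u y) ^+ 2) <=
   (b ^+ 2)%:E * sumV (fun x => u x ^+ 2))%E.
Proof.
move=> b0 k0 ksym kN kb; apply: sumV_le_ub => F.
pose U := (\bigcup_(x <- F) N x)%fset.
apply: (@le_trans _ _ ((b ^+ 2)%:E * (\sum_(y <- U) u y ^+ 2)%:E)%E); last first.
  apply: lee_wpmul2l; first by rewrite lee_fin sqr_ge0.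
  by apply: fset_sum_le_sumV => x; exact: sqr_ge0.
rewrite -EFinM lee_fin.
apply: (@le_trans _ _ (\sum_(x <- F) b * \sum_(y <- U) k x y * u y ^+ 2)).
  rewrite big_seq [leRHS]big_seq; apply: ler_sum => x xF.
  rewrite -(@big_fset_incl _ _ _ _ (N x) U) => [| |y _ /kN ->]; last 1 first.
  - by rewrite mul0r.
  - exact: weighted_cauchy_schwarz.
  - by apply/fsubsetP => y yN; apply/bigfcupP; exists x => //; rewrite xF.
rewrite -mulr_sumr exchange_big/= expr2 -mulrA ler_pM2l// mulr_sumr.
apply: ler_sum => y _; rewrite -mulr_suml ler_wpM2r ?sqr_ge0//.
apply: le_trans (kb y).
rewrite (@big_fset_incl _ _ _ _ (N y) (F `|` N y)%fset) ?fsubsetUr//; last first.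
  by move=> x _ /kN.
under eq_bigr do rewrite ksym.
by apply: ler_sum_fsubset => //; exact: fsubsetUl.
Qed.

End Schur.

(** * The modulus of complex numbers *)

Section Modulus.
Context {R : realType}.

Lemma normc_ge0 (z : R[i]) : 0 <= normc z.
Proof. by case: z => a b; exact: sqrtr_ge0. Qed.

Lemma sqr_normcE (z : R[i]) : normc z ^+ 2 = complex.Re z ^+ 2 + complex.Im z ^+ 2.
Proof. by case: z => a b; rewrite sqr_sqrtr// addr_ge0// sqr_ge0. Qed.

Lemma normcJ (z : R[i]) : normc (conjc z) = normc z.
Proof. by case: z => a b; rewrite /normc/= sqrrN. Qed.

Lemma Re_le_normc (z : R[i]) : `|complex.Re z| <= normc z.
Proof.
rewrite -ler_sqr ?nnegrE ?normc_ge0// real_normK ?num_real// sqr_normcE.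
by rewrite lerDl sqr_ge0.
Qed.

Lemma Im_le_normc (z : R[i]) : `|complex.Im z| <= normc z.
Proof.
rewrite -ler_sqr ?nnegrE ?normc_ge0// real_normK ?num_real// sqr_normcE.
by rewrite lerDr sqr_ge0.
Qed.

Lemma normc_le_ReDIm (z : R[i]) : normc z <= `|complex.Re z| + `|complex.Im z|.
Proof.
rewrite -ler_sqr ?nnegrE ?normc_ge0 ?addr_ge0// sqr_normcE sqrrD !real_normK ?num_real//.
by rewrite lerD2r lerDl mulrn_wge0 ?mulr_ge0.
Qed.

Lemma normc_real (r : R) : normc r%:C%C = `|r|.
Proof. by rewrite /normc/= expr0n/= addr0 sqrtr_sqr. Qed.

Lemma normc_sum (I : Type) (s : seq I) (F : I -> R[i]) :
  normc (\sum_(y <- s) F y) <= \sum_(y <- s) normc (F y).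
Proof.
elim/big_rec2: _ => [|y a b _ ab]; first by rewrite normc0.
by apply: (le_trans (le_normcD _ _)); rewrite lerD2l.
Qed.

Lemma eq0_normc_lt (z : R[i]) : (forall e : R, 0 < e -> normc z < e) -> z = 0.
Proof.
move=> ze; apply: eq0_normc; apply/eqP; rewrite eq_le normc_ge0 andbT leNgt.
by apply/negP => /ze; rewrite ltxx.
Qed.

End Modulus.

(** * Continuity of the inner product *)

Section Inner.
Context {R : realType} {V : countType}.
Implicit Types (f g : V -> R[i]) (u v : V -> R).

(** This estimate gives continuity of the sums without first proving them
linear: it compares the positive and the negative parts separately, which is
where the factor 2 comes from. *)
Lemma rsum_dist u v (c : R) : (sumV (fun x => `|u x|) < +oo)%E ->
  (sumV (fun x => `|v x|) < +oo)%E -> (sumV (fun x => `|u x - v x|) <= c%:E)%E ->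
  `|rsum u - rsum v| <= 2 * c.
Proof.
move=> usum vsum uv.
(* With s = 1 and s = -1 this treats both parts at once. *)
have part (w : V -> R) (s : R) : `|s| = 1 -> (sumV (fun x => `|w x|) < +oo)%E ->
    exists2 r : R, 0 <= r & sumV (fun x => Num.max (s * w x) 0) = r%:E.
  move=> s1 wsum; apply: sumV_lt_pinfty_fin => [x|].
    by rewrite le_max lexx orbT.
  apply: le_lt_trans wsum; apply: le_sumV => x.
  by rewrite ge_max normr_ge0 andbT (le_trans (ler_norm _))// normrM s1 mul1r.
have diff (w w' : V -> R) (s : R) : `|s| = 1 -> (sumV (fun x => `|w x - w' x|) <= c%:E)%E ->
    (sumV (fun x => Num.max (s * w x) 0) <=
     sumV (fun x => Num.max (s * w' x) 0) + c%:E)%E.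
  move=> s1 ww'; apply: le_trans (leeD2l _ ww').
  rewrite -sumVD => [|x|x]; last 2 first.
  - by rewrite le_max lexx orbT.
  - exact: normr_ge0.
  apply: le_sumV => x /=; have : s * (w x - w' x) <= `|w x - w' x|.
    by rewrite (le_trans (ler_norm _))// normrM s1 mul1r.
  rewrite mulrBr => h; rewrite ge_max; apply/andP; split.
    by apply: (@le_trans _ _ (s * w' x + `|w x - w' x|)); [lra|rewrite lerD2r le_max lexx].
  by rewrite addr_ge0// le_max lexx orbT.
have vu : (sumV (fun x => `|v x - u x|) <= c%:E)%E.
  by apply: le_trans uv; apply: le_sumV => x; rewrite distrC.
have n1 : `|1| = 1 :> R by rewrite normr1.
have nN1 : `|-1| = 1 :> R by rewrite normrN1.
have posE (w : V -> R) : sumV (fun x => Num.max (w x) 0) = sumV (fun x => Num.max (1 * w x) 0).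
  by apply: eq_esum => x _; rewrite mul1r.
have negE (w : V -> R) : sumV (fun x => Num.max (- w x) 0) = sumV (fun x => Num.max (-1 * w x) 0).
  by apply: eq_esum => x _; rewrite mulN1r.
rewrite /rsum (posE u) (posE v) (negE u) (negE v).
have := diff _ _ _ n1 uv; have := diff _ _ _ n1 vu.
have := diff _ _ _ nN1 uv; have := diff _ _ _ nN1 vu.
have [p1 _ ->] := part _ _ n1 usum; have [p2 _ ->] := part _ _ n1 vsum.
have [p3 _ ->] := part _ _ nN1 usum; have [p4 _ ->] := part _ _ nN1 vsum.
rewrite -!EFinD !lee_fin /= => h1 h2 h3 h4.
by rewrite ler_norml; apply/andP; split; lra.
Qed.

Lemma csum_dist f g (c : R) : (sumV (fun x => normc (f x)) < +oo)%E ->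
  (sumV (fun x => normc (g x)) < +oo)%E ->
  (sumV (fun x => normc (f x - g x)) <= c%:E)%E ->
  normc (csum f - csum g) <= 4 * c.
Proof.
move=> fsum gsum fg; apply: (le_trans (normc_le_ReDIm _)).
have ReB (z w : R[i]) : complex.Re (z - w) = complex.Re z - complex.Re w.
  by case: z w => ? ? [].
have ImB (z w : R[i]) : complex.Im (z - w) = complex.Im z - complex.Im w.
  by case: z w => ? ? [].
rewrite ReB ImB /csum /=.
have re := rsum_dist (u := fun x => complex.Re (f x)) (v := fun x => complex.Re (g x)) (c := c).
have im := rsum_dist (u := fun x => complex.Im (f x)) (v := fun x => complex.Im (g x)) (c := c).
have -> : 4 * c = 2 * c + 2 * c by ring.
apply: lerD; [apply: re|apply: im].
- by apply: le_lt_trans fsum; apply: le_sumV => x; exact: Re_le_normc.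
- by apply: le_lt_trans gsum; apply: le_sumV => x; exact: Re_le_normc.
- by apply: le_trans fg; apply: le_sumV => x /=; rewrite -ReB; exact: Re_le_normc.
- by apply: le_lt_trans fsum; apply: le_sumV => x; exact: Im_le_normc.
- by apply: le_lt_trans gsum; apply: le_sumV => x; exact: Im_le_normc.
- by apply: le_trans fg; apply: le_sumV => x /=; rewrite -ImB; exact: Im_le_normc.
Qed.

Lemma rsum_fsupp u (F : {fset V}) : (forall x, x \notin F -> u x = 0) ->
  rsum u = \sum_(x <- F) u x.
Proof.
move=> uF; rewrite /rsum (@sumV_fsupp _ _ _ F) => [|x|x /uF ->]; last 2 first.
- by rewrite le_max lexx orbT.
- by rewrite maxxx.
rewrite (@sumV_fsupp _ _ _ F) => [|x|x /uF ->]; last 2 first.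
- by rewrite le_max lexx orbT.
- by rewrite oppr0 maxxx.
rewrite /= -sumrB; apply: eq_bigr => x _.
by case: (leP (u x) 0); case: (leP (- u x) 0); lra.
Qed.

Lemma csum_fsupp f (F : {fset V}) : (forall x, x \notin F -> f x = 0) ->
  csum f = \sum_(x <- F) f x.
Proof.
move=> fF; rewrite /csum !(@rsum_fsupp _ F) => [|x /fF -> //|x /fF -> //].
elim/big_rec3: _ => [//|x a b c _ <-].
by case: (f x).
Qed.

Lemma inner_fsupp f g (F : {fset V}) : (forall x, x \notin F -> f x = 0) ->
  inner f g = \sum_(x <- F) f x * conjc (g x).
Proof. by move=> fF; apply: csum_fsupp => x /fF ->; rewrite mul0r. Qed.

(** The free parameter [t] does the work of the Cauchy-Schwarz inequality in
[inner_continuous]: a large [t] makes the term of the fixed factor [g] small, and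
closeness of the first arguments then controls the other term. *)
Lemma sumV_mul_ell2 f g (t : R) : 0 < t ->
  (sumV (fun x => normc (f x * conjc (g x))) <=
   t%:E * sqnorm f + (t^-1)%:E * sqnorm g)%E.
Proof.
move=> t0; have ti0 : 0 <= t^-1 by rewrite invr_ge0 ltW.
have sq0 h (x : V) : 0 <= normc (h x) ^+ 2 :> R by exact: sqr_ge0.
apply: (@le_trans _ _ (sumV ((fun x => t * normc (f x) ^+ 2) \+
                             (fun x => t^-1 * normc (g x) ^+ 2)))).
  apply: le_sumV => x; rewrite normcM normcJ /=.
  set a := normc (f x); set b := normc (g x).
  have a0 : 0 <= a by exact: normc_ge0.
  have b0 : 0 <= b by exact: normc_ge0.
  have -> : t * a ^+ 2 + t^-1 * b ^+ 2 = t^-1 * (t * a - b) ^+ 2 + a * b + a * b.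
    by field; rewrite gt_eqF.
  by rewrite lerDr addr_ge0// mulr_ge0// sqr_ge0.
rewrite sumVD => [|x|x]; last 2 first.
- by apply: mulr_ge0 => //; rewrite ltW.
- exact: mulr_ge0.
by apply: leeD; apply: sumVZ_le => //; exact: ltW.
Qed.

Lemma ell2_fin f : ell2 f -> exists2 r : R, 0 <= r & sqnorm f = r%:E.
Proof. by move=> fl2; apply: sumV_lt_pinfty_fin => // x; exact: sqr_ge0. Qed.

Lemma inner_continuous g (e : R) : ell2 g -> 0 < e -> exists2 s : R, 0 < s &
  forall f f', ell2 f -> ell2 f' -> (sqnorm (f \- f')%R < (s ^+ 2)%:E)%E ->
  normc (inner f g - inner f' g) < e.
Proof.
move=> gl2 e0; have [B B0 gB] := ell2_fin gl2.
have summ f : ell2 f -> (sumV (fun x => normc (f x * conjc (g x))) < +oo)%E.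
  move=> /ell2_fin [A A0 fA]; apply: (le_lt_trans (sumV_mul_ell2 _ _ ltr01)).
  by rewrite fA gB -!EFinM -EFinD ltry.
(* Four times the bound of sumV_mul_ell2 is then at most e / 4 + e / 4. *)
pose t := 16 * (B + 1) / e; pose s := Num.sqrt (e / (16 * t)).
have t0 : 0 < t by rewrite divr_gt0// mulr_gt0//; lra.
have r0 : 0 < e / (16 * t) by rewrite divr_gt0// mulr_gt0.
exists s; first by rewrite sqrtr_gt0.
move=> f f' fl2 f'l2; rewrite sqr_sqrtr ?(ltW r0)// => ff'.
apply: (@le_lt_trans _ _ (4 * (t * (e / (16 * t)) + t^-1 * B))).
  apply: csum_dist; [exact: summ|exact: summ|].
  apply: (@le_trans _ _ (sumV (fun x => normc ((f \- f') x * conjc (g x))))).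
    by apply: le_sumV => x; rewrite mulrBl.
  apply: (le_trans (sumV_mul_ell2 _ _ t0)).
  rewrite gB EFinD (EFinM t) (EFinM _ B); apply: leeD2r.
  by apply: lee_wpmul2l; [rewrite lee_fin ltW|exact: ltW].
have -> : 4 * (t * (e / (16 * t)) + t^-1 * B) = e / 4 + e * (B / (4 * (B + 1))).
  have B1 : B + 1 != 0 by rewrite gt_eqF//; lra.
  by rewrite /t; field; rewrite B1 gt_eqF.
have : B / (4 * (B + 1)) <= 1 / 4.
  by rewrite ler_pdivrMr; [lra|lra].
nra.
Qed.

Lemma finitely_supportedE f : finitely_supported f ->
  exists F : {fset V}, forall x, x \notin F -> f x = 0.
Proof.
move=> fin; exists (fset_set [set x | f x != 0]) => x.
rewrite in_fset_set// => /negP xF; apply/eqP/negPn/negP => fx.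
by apply: xF; rewrite inE.
Qed.

Lemma finitely_supported_fset f (F : {fset V}) :
  (forall x, x \notin F -> f x = 0) -> finitely_supported f.
Proof.
move=> fF; apply: (sub_finite_set _ (finite_fset F)) => x /= fx.
by apply/negPn/negP => /fF/eqP; exact/negP.
Qed.

Lemma finitely_supported_ell2 f : finitely_supported f -> ell2 f.
Proof.
move=> /finitely_supportedE[F fF]; rewrite /ell2/= /sqnorm (@sumV_fsupp _ _ _ F) ?ltry//.
  by move=> x; exact: sqr_ge0.
by move=> x /fF ->; rewrite normc0 expr0n.
Qed.

Lemma normc_le_sqnorm f x : ((normc (f x) ^+ 2)%:E <= sqnorm f)%E.
Proof.
have := @fset_sum_le_sumV _ _ (fun x => normc (f x) ^+ 2) [fset x]%fset.
by rewrite big_seq_fset1; apply => y; exact: sqr_ge0.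
Qed.

End Inner.

(** * The maximal operator *)

Section MaximalOperator.
Context {R : realType} {V : countType} (G : wgraph R V).
Hypothesis Gfin : locally_finite G.
Implicit Types (f g h : V -> R[i]) (x y : V).

Lemma in_neighbors x y : (y \in neighbors G x) = (G x y != 0).
Proof.
rewrite /neighbors in_fset_set; last exact: Gfin.
by apply/idP/idP; rewrite inE.
Qed.

Lemma neighbors_sym x y : (y \in neighbors G x) = (x \in neighbors G y).
Proof. by rewrite !in_neighbors weight_sym. Qed.

Lemma weight_nonneighbor x y : y \notin neighbors G x -> G x y = 0.
Proof. by rewrite in_neighbors negbK => /eqP. Qed.

Lemma adjacency_widen f x (F : {fset V}) :
  (neighbors G x `<=` F)%fset ->
  adjacency G f x = \sum_(y <- F) (G x y)%:C%C * f y.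
Proof.
move=> NF; apply: big_fset_incl => // y _ /weight_nonneighbor ->.
by rewrite mul0r.
Qed.

Lemma adjacency_fsupp f (F : {fset V}) x : (forall y, y \notin F -> f y = 0) ->
  adjacency G f x = \sum_(y <- F) (G x y)%:C%C * f y.
Proof.
move=> fF; rewrite (@adjacency_widen _ _ (F `|` neighbors G x)%fset) ?fsubsetUr//.
symmetry; apply: big_fset_incl; first exact: fsubsetUl.
by move=> y _ /fF ->; rewrite mulr0.
Qed.

Lemma adjacencyB f g x :
  adjacency G (f \- g) x = adjacency G f x - adjacency G g x.
Proof. by rewrite -sumrB; apply: eq_bigr => y _; rewrite mulrBr. Qed.

Lemma adjacency_fsupp_vanish f (F : {fset V}) : (forall x, x \notin F -> f x = 0) ->
  forall x, x \notin (\bigcup_(y <- F) neighbors G y)%fset -> adjacency G f x = 0.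
Proof.
move=> fF x xF; rewrite (adjacency_fsupp _ fF) big_seq big1// => y yF.
rewrite weight_nonneighbor ?mul0r// neighbors_sym.
by apply: contra xF => xy; apply/bigfcupP; exists y => //; rewrite yF.
Qed.

Lemma finitely_supported_adjacency f :
  finitely_supported f -> finitely_supported (adjacency G f).
Proof.
move=> /finitely_supportedE[F fF].
exact: finitely_supported_fset (adjacency_fsupp_vanish fF).
Qed.

(** Only one of the two functions needs finite support: both sides are then
finite double sums, even when [g] is arbitrary. *)
Lemma adjacency_symmetric f g : finitely_supported f ->
  inner (adjacency G f) g = inner f (adjacency G g).
Proof.
move=> /finitely_supportedE[F fF].
set U := (\bigcup_(y <- F) neighbors G y)%fset.
rewrite (inner_fsupp _ (adjacency_fsupp_vanish fF)) -/U (inner_fsupp _ fF).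
under eq_bigr do rewrite (adjacency_fsupp _ fF) mulr_suml.
rewrite exchange_big/= big_seq [RHS]big_seq; apply: eq_bigr => y yF.
rewrite (@adjacency_widen _ _ U); last first.
  by apply/fsubsetP => x xy; apply/bigfcupP; exists y => //; rewrite yF.
rewrite rmorph_sum mulr_sumr; apply: eq_bigr => x _.
rewrite rmorphM weight_sym /= oppr0 mulrA; congr (_ * _); rewrite mulrC.
by [].
Qed.

Definition cfdelta x : V -> R[i] := fun y => (y == x)%:R.

Lemma inner_delta x g : inner (cfdelta x) g = conjc (g x).
Proof.
rewrite (@inner_fsupp _ _ _ _ [fset x]%fset); last first.
  by move=> y; rewrite inE /cfdelta => /negbTE ->.
by rewrite big_seq_fset1 /cfdelta eqxx mul1r.
Qed.

Lemma cfdelta_fsupp x : finitely_supported (cfdelta x).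
Proof.
apply: (@finitely_supported_fset _ _ _ [fset x]%fset) => y.
by rewrite inE /cfdelta => /negbTE ->.
Qed.

(** Testing the adjoint relation against the point mass at [x] evaluates both
sides at [x]. *)
Lemma adjoint_adjacency (T : set ((V -> R[i]) * (V -> R[i]))) p :
  adjacency_op G `<=` T -> op_adjoint T p -> p.2 = adjacency G p.1.
Proof.
move=> AT [_ _ Tp]; apply/funext => x.
have := Tp (cfdelta x, adjacency G (cfdelta x)).
move=> /(_ (AT _ (ex_intro2 _ _ _ (cfdelta_fsupp x) erefl)))/=.
rewrite (adjacency_symmetric _ (cfdelta_fsupp x)) !inner_delta.
by move=> /(inv_inj (@conjcK _)).
Qed.

(** Convergence in norm implies pointwise convergence, and the value of
[adjacency G g] at a vertex depends on finitely many values of [g]. *)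
Lemma closure_adjacency p :
  op_closure (adjacency_op G) p -> p.2 = adjacency G p.1.
Proof.
case: p => g h [/= gl2 hl2 app]; apply/funext => x; apply/eqP.
rewrite -subr_eq0; apply/eqP/eq0_normc_lt => e e0.
pose W := 1 + \sum_(y <- neighbors G x) G x y.
have W0 : 1 <= W by rewrite lerDl sumr_ge0// => y _; exact: weight_ge0.
have d0 : 0 < e / (2 * W) by rewrite divr_gt0// mulr_gt0//; lra.
have [[f _] [f' _ [<- <-]]] := app _ d0; move=> /= [gf hf].
have lt_pt k y : (sqnorm k < ((e / (2 * W)) ^+ 2)%:E)%E -> normc (k y) < e / (2 * W).
  move=> /(le_lt_trans (normc_le_sqnorm k y)); rewrite lte_fin.
  by rewrite ltr_sqr// ?nnegrE ?normc_ge0// ltW.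
have -> : h x - adjacency G g x =
    (h x - adjacency G f' x) - adjacency G (g \- f') x.
  by rewrite adjacencyB; ring.
apply: (le_lt_trans (le_normcD _ _)); rewrite normcN.
have h1 := lt_pt _ x hf.
have h2 : normc (adjacency G (g \- f') x) <= (W - 1) * (e / (2 * W)).
  have -> : W - 1 = \sum_(y <- neighbors G x) G x y by rewrite /W; ring.
  apply: (le_trans (normc_sum _ _)).
  rewrite mulr_suml; apply: ler_sum => y _.
  rewrite normcM normc_real ger0_norm ?weight_ge0//.
  by rewrite ler_wpM2l ?weight_ge0// ltW// (lt_pt _ y gf).
have -> : e = W * (e / (2 * W)) + W * (e / (2 * W)) by field; rewrite gt_eqF//; lra.
move: h1 h2 => /=; set d := e / (2 * W) in d0 *; nra.
Qed.

(** Under the core property the closure contains the maximal operator, hence the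
adjoint.  Conversely, two pairs of the closure satisfy the adjoint relation
because it holds for finitely supported functions and passes to the limit. *)
Lemma essentially_self_adjoint_of_core :
  (forall g (e : R), ell2 g -> ell2 (adjacency G g) -> 0 < e ->
    exists f, [/\ finitely_supported f, (sqnorm (g \- f)%R < (e ^+ 2)%:E)%E &
      (sqnorm (adjacency G g \- adjacency G f)%R < (e ^+ 2)%:E)%E]) ->
  essentially_self_adjoint (adjacency_op G).
Proof.
move=> core; set T := op_closure (adjacency_op G).
have TP p : ell2 p.1 -> ell2 p.2 -> p.2 = adjacency G p.1 -> T p.
  case: p => g h /= gl2 hl2 hE; subst h; split => //= e e0.
  have [f [fs gf Agf]] := core g e gl2 hl2 e0.
  by exists (f, adjacency G f) => //; exists f.
have AT : adjacency_op G `<=` T.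
  move=> _ [f fs <-]; apply: TP => //=; apply: finitely_supported_ell2 => //.
  exact: finitely_supported_adjacency.
apply/seteqP; split=> p; last first.
  by move=> Tp; apply: TP; [case: Tp|case: Tp|exact: adjoint_adjacency Tp].
move=> Tp; have p2E := closure_adjacency Tp; case: Tp => p1l2 p2l2 _.
split=> // q Tq; have q2E := closure_adjacency Tq; case: Tq => q1l2 q2l2 _.
apply/eqP; rewrite -subr_eq0; apply/eqP/eq0_normc_lt => e e0.
have e20 : 0 < e / 2 by rewrite divr_gt0.
have [s s0 sP] := inner_continuous p1l2 e20.
have [t t0 tP] := inner_continuous p2l2 e20.
have m0 : 0 < Num.min s t by rewrite lt_min s0.
rewrite q2E in q2l2 *.
have [f [fs qf Aqf]] := core q.1 _ q1l2 q2l2 m0.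
have {}qf : (sqnorm (q.1 \- f)%R < (t ^+ 2)%:E)%E.
  apply: (lt_le_trans qf); rewrite lee_fin ler_sqr ?nnegrE ?(ltW m0) ?(ltW t0)//.
  by rewrite ge_min lexx orbT.
have {}Aqf : (sqnorm (adjacency G q.1 \- adjacency G f)%R < (s ^+ 2)%:E)%E.
  apply: (lt_le_trans Aqf); rewrite lee_fin ler_sqr ?nnegrE ?(ltW m0) ?(ltW s0)//.
  by rewrite ge_min lexx.
have fl2 := finitely_supported_ell2 fs.
have Afl2 := finitely_supported_ell2 (finitely_supported_adjacency fs).
have := sP _ _ q2l2 Afl2 Aqf; have := tP _ _ q1l2 fl2 qf.
rewrite (adjacency_symmetric _ fs) -p2E => h1 h2.
rewrite (_ : _ - _ = (inner (adjacency G q.1) p.1 - inner f p.2)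
  - (inner q.1 p.2 - inner f p.2)); last by ring.
apply: (le_lt_trans (le_normcD _ _)); rewrite normcN; lra.
Qed.

End MaximalOperator.

(** * Cutoffs along a potential *)

Section Clamp.
Context {R : realType}.
Implicit Types s t : R.

Definition clamp t : R := Num.max 0 (Num.min 1 (2 - t)).

Lemma clamp_ge0 t : 0 <= clamp t.
Proof. by rewrite le_max lexx. Qed.

Lemma clamp_le1 t : clamp t <= 1.
Proof. by rewrite ge_max ler01 ge_min lexx. Qed.

Lemma clamp1 t : t <= 1 -> clamp t = 1.
Proof.
move=> t1; rewrite /clamp; case: (leP 1 (2 - t)); last by lra.
by move=> _; case: (leP (0 : R) 1) => //; lra.
Qed.

Lemma clamp0 t : 2 <= t -> clamp t = 0.
Proof.
move=> t2; rewrite /clamp; case: (leP 1 (2 - t)); first by lra.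
by move=> _; case: (leP 0 (2 - t)) => //; lra.
Qed.

Lemma clamp_lipschitz s t : `|clamp s - clamp t| <= `|s - t|.
Proof.
rewrite /clamp ler_norml.
have h1 := ler_norm (s - t); have h2 := ler_norm (- (s - t)).
rewrite normrN in h2.
case: (leP 1 (2 - s)) => ?; case: (leP 1 (2 - t)) => ?;
  (case: (leP (0 : R) 1) => ?; last by lra);
  try case: (leP 0 (2 - s)) => ?; try case: (leP 0 (2 - t)) => ?;
  by apply/andP; split; lra.
Qed.

End Clamp.

Section Core.
Context {R : realType} {V : countType} (G : wgraph R V).
Hypothesis Gfin : locally_finite G.
Implicit Types (x y : V) (n : R) (u : V -> R).
Variables (L : V -> R) (C : R).
Hypothesis C0 : 0 < C.
Hypothesis Lrow : forall x, \sum_(y <- neighbors G x) G x y <= L x.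
Hypothesis Llip : forall x y, G x y != 0 -> `|L x - L y| <= C.

Lemma potential_ge0 x : 0 <= L x.
Proof. by apply: le_trans (Lrow x); apply: sumr_ge0 => y _; exact: weight_ge0. Qed.

(** Damping the weights by a factor [phi] that vanishes far out makes the kernel
bounded: where [phi] is nonzero the row sums are at most [c * L x], and there
[L x] is at most [2 * n + C]. *)
Lemma localized_schur (n c : R) (phi : V -> V -> R) (u : V -> R) :
  0 < n -> 0 < c -> (forall x y, 0 <= phi x y <= c) ->
  (forall x y, phi x y = phi y x) ->
  (forall x y, G x y != 0 -> 2 * n + C < L x -> phi x y = 0) ->
  (sumV (fun x => (\sum_(y <- neighbors G x) G x y * phi x y * u y) ^+ 2) <=
   ((c * (2 * n + C)) ^+ 2)%:E * sumV (fun x => u x ^+ 2))%E.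
Proof.
move=> n0 c0 phic phisym phi0.
have phi_ge0 x y : 0 <= phi x y by case/andP: (phic x y).
have nC : 0 < 2 * n + C by rewrite addr_gt0// mulr_gt0.
apply: (@schur_test _ _ (neighbors G) (fun x y => G x y * phi x y)).
- exact: mulr_gt0.
- by move=> x y; rewrite mulr_ge0// weight_ge0.
- by move=> x y; rewrite weight_sym phisym.
- by move=> x y /(weight_nonneighbor Gfin) ->; rewrite mul0r.
move=> x; case: (ltP (2 * n + C) (L x)) => Lx.
  rewrite big_seq big1 ?mulr_ge0 ?ltW// => y; rewrite in_neighbors// => xy.
  by rewrite phi0// mulr0.
apply: (@le_trans _ _ (c * L x)); last by rewrite ler_pM2l.
apply: (@le_trans _ _ (c * \sum_(y <- neighbors G x) G x y)); last by rewrite ler_pM2l.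
rewrite mulr_sumr; apply: ler_sum => y _; rewrite mulrC.
by apply: ler_wpM2r; [exact: weight_ge0|case/andP: (phic x y)].
Qed.

Definition cutoff (n : R) (x : V) : R := clamp (L x / n).

Lemma cutoff_eq1 n x : 0 < n -> L x <= n -> cutoff n x = 1.
Proof. by move=> n0 Lx; rewrite /cutoff clamp1// ler_pdivrMr// mul1r. Qed.

Lemma cutoff_eq0 n x : 0 < n -> 2 * n <= L x -> cutoff n x = 0.
Proof. by move=> n0 Lx; rewrite /cutoff clamp0// ler_pdivlMr. Qed.

Lemma cutoff_lipschitz n x y : 0 < n -> G x y != 0 ->
  `|cutoff n x - cutoff n y| <= C / n.
Proof.
move=> n0 xy; apply: (le_trans (clamp_lipschitz _ _)).
rewrite -mulrBl normrM (gtr0_norm (x := n^-1)) ?invr_gt0//.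
by rewrite ler_pM2r ?invr_gt0// Llip.
Qed.

Lemma cutoff_eq0_edge n x y : 0 < n -> G x y != 0 -> 2 * n + C < L x ->
  cutoff n x = 0 /\ cutoff n y = 0.
Proof.
move=> n0 xy Lx; have Cgt0 := C0; have := Llip xy; rewrite ler_norml => /andP[_ LC].
by split; apply: cutoff_eq0 => //; lra.
Qed.

(** The bound does not depend on [n]: the Lipschitz constant [C / n] of the
cutoff compensates the growth [2 * n + C] of the row sums on its support. *)
Lemma commutator_schur n u : C <= n ->
  (sumV (fun x => (\sum_(y <- neighbors G x)
     G x y * `|cutoff n x - cutoff n y| * u y) ^+ 2) <=
   ((3 * C) ^+ 2)%:E * sumV (fun x => u x ^+ 2))%E.
Proof.
move=> Cn; have Cgt0 := C0; have n0 : 0 < n := lt_le_trans Cgt0 Cn.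
have Cn0 : 0 < C / n by rewrite divr_gt0.
(* Off the edges the cutoff need not be Lipschitz, so phi is set to 0 there. *)
pose phi x y := if G x y != 0 then `|cutoff n x - cutoff n y| else 0.
apply: (@le_trans _ _ (((C / n * (2 * n + C)) ^+ 2)%:E * sumV (fun x => u x ^+ 2))%E).
  apply: le_trans (localized_schur (phi := phi) u n0 Cn0 _ _ _).
  - apply: le_sumV => x; rewrite le_eqVlt; apply/orP; left; apply/eqP.
    congr (_ ^+ 2); apply: eq_big_seq => y.
    by rewrite in_neighbors// /phi => ->.
  - move=> x y; rewrite /phi; case: ifPn => [xy|_]; last by rewrite lexx ltW.
    by rewrite normr_ge0 cutoff_lipschitz.
  - by move=> x y; rewrite /phi weight_sym distrC.
  - move=> x y xy Lx; rewrite /phi xy; have [-> ->] := cutoff_eq0_edge n0 xy Lx.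
    by rewrite subrr normr0.
apply: lee_wpmul2r; first by apply: sumV_ge0 => x; exact: sqr_ge0.
rewrite lee_fin ler_sqr ?nnegrE.
- have -> : C / n * (2 * n + C) = 2 * C + C * (C / n) by field; rewrite gt_eqF.
  have : C / n <= 1 by rewrite ler_pdivrMr// mul1r.
  by nra.
- by rewrite mulr_ge0 ?(ltW Cn0)//; lra.
- by lra.
Qed.

Lemma cutoff_ge0 n x : 0 <= cutoff n x. Proof. exact: clamp_ge0. Qed.
Lemma cutoff_le1 n x : cutoff n x <= 1. Proof. exact: clamp_le1. Qed.

(** The kernel [G x y * cutoff n y] of the adjacency matrix restricted to the
support of the cutoff is not symmetric; adding [cutoff n x] gives a symmetric
majorant with the same localization. *)
Lemma truncation_schur n u : 0 < n ->
  (sumV (fun x => (\sum_(y <- neighbors G x)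
     G x y * (cutoff n x + cutoff n y) * u y) ^+ 2) <=
   ((2 * (2 * n + C)) ^+ 2)%:E * sumV (fun x => u x ^+ 2))%E.
Proof.
move=> n0.
pose phi x y := if G x y != 0 then cutoff n x + cutoff n y else 0.
have c0 := cutoff_ge0; have c1 := cutoff_le1.
apply: le_trans (localized_schur (phi := phi) u n0 _ _ _ _) => //.
- apply: le_sumV => x; rewrite le_eqVlt; apply/orP; left; apply/eqP.
  congr (_ ^+ 2); apply: eq_big_seq => y.
  by rewrite in_neighbors// /phi => ->.
- move=> x y; rewrite /phi; have := (c0 n x, c1 n x, c0 n y, c1 n y).
  by case: ifP => _ [[[? ?] ?] ?]; apply/andP; split; lra.
- by move=> x y; rewrite /phi weight_sym addrC.
- move=> x y xy Lx; rewrite /phi xy; have [-> ->] := cutoff_eq0_edge n0 xy Lx.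
  by rewrite addr0.
Qed.

Definition truncation n (F : {fset V}) (g : V -> R[i]) : V -> R[i] :=
  fun x => (if x \in F then cutoff n x else 0)%:C%C * g x.

Definition off (F : {fset V}) (g : V -> R[i]) (x : V) : R :=
  if x \in F then 0 else normc (g x).

Lemma sqr_off F g x : off F g x ^+ 2 = if x \in F then 0 else normc (g x) ^+ 2.
Proof. by rewrite /off; case: ifP; rewrite ?expr0n. Qed.

(** The three terms come from splitting [g y - truncation n F g y] as
[(1 - cutoff n x) * g y], which sums to a multiple of [adjacency G g x], the
commutator part [(cutoff n x - cutoff n y) * g y], and the part removed by
restricting to [F].  On [K] and next to it the cutoff is 1, so the first two
involve only the values off [K]. *)
Lemma truncation_error n (K F : {fset V}) g x : 0 < n ->
  (forall y, y \in K -> L y + C <= n) ->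
  normc (adjacency G g x - adjacency G (truncation n F g) x) <=
  off K (adjacency G g) x +
  \sum_(y <- neighbors G x) G x y * `|cutoff n x - cutoff n y| * off K g y +
  \sum_(y <- neighbors G x) G x y * (cutoff n x + cutoff n y) * off F g y.
Proof.
move=> n0 Kn; have Cgt0 := C0; have c0 := cutoff_ge0 n; have c1 := cutoff_le1 n.
have -> : adjacency G g x - adjacency G (truncation n F g) x =
  (1 - cutoff n x)%:C%C * adjacency G g x
  + \sum_(y <- neighbors G x) (G x y)%:C%C * ((cutoff n x - cutoff n y)%:C%C * g y)
  + \sum_(y <- neighbors G x)
      (G x y)%:C%C * ((cutoff n y - (if y \in F then cutoff n y else 0))%:C%C * g y).
  rewrite /adjacency mulr_sumr -sumrB -!big_split/=; apply: eq_bigr => y _.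
  by rewrite /truncation !rmorphB rmorph1; ring.
apply: (le_trans (le_normcD _ _)); apply: lerD.
  apply: (le_trans (le_normcD _ _)); apply: lerD.
    rewrite normcM normc_real /off; case: ifPn => [xK|_].
      by rewrite cutoff_eq1 ?subrr ?normr0 ?mul0r//; have := Kn x xK; lra.
    rewrite ler_piMl ?normc_ge0// ger0_norm; have := (c0 x, c1 x).
      by move=> [? ?]; lra.
    by move=> [? ?]; lra.
  apply: (le_trans (normc_sum _ _)); rewrite big_seq [leRHS]big_seq.
  apply: ler_sum => y; rewrite in_neighbors// => xy.
  rewrite !normcM !normc_real ger0_norm ?weight_ge0// -mulrA.
  rewrite ler_wpM2l ?weight_ge0// /off; case: ifPn => // yK.
  have := Llip xy; rewrite ler_norml => /andP[_ LC]; have := Kn y yK => LK.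
  rewrite !cutoff_eq1//; [|lra|lra].
  by rewrite subrr normr0 mul0r mulr0.
apply: (le_trans (normc_sum _ _)); apply: ler_sum => y _.
rewrite !normcM !normc_real ger0_norm ?weight_ge0// -mulrA.
rewrite ler_wpM2l ?weight_ge0// /off; case: ifPn => yF.
  by rewrite subrr normr0 mul0r mulr0.
by rewrite subr0 ler_wpM2r ?normc_ge0// ger0_norm// lerDr.
Qed.

Lemma sumV_sqr3 (p q r : V -> R) :
  (sumV (fun x => (p x + q x + r x) ^+ 2) <=
   3%:E * (sumV (fun x => p x ^+ 2) + sumV (fun x => q x ^+ 2)
          + sumV (fun x => r x ^+ 2)))%E.
Proof.
rewrite -sumVD => [|x|x]; [|exact: sqr_ge0|exact: sqr_ge0].
rewrite -sumVD => [|x|x]; [|by rewrite addr_ge0// sqr_ge0|exact: sqr_ge0].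
apply: le_trans (sumVZ_le _ _) => [|//|x]; last by rewrite /= !addr_ge0// sqr_ge0.
apply: le_sumV => x /=.
rewrite -subr_ge0 (_ : _ - _ = (p x - q x) ^+ 2 + (q x - r x) ^+ 2 + (p x - r x) ^+ 2);
  last by ring.
by rewrite !addr_ge0// sqr_ge0.
Qed.

(** The order of the choices matters: the finite set [K] carries all but a small
part of [g] and [A g], with a smallness independent of [n]; then [n] is so large
that the cutoff is 1 around [K]; the final truncation set [F] may depend on [n],
since the bound of [truncation_schur] does. *)
Lemma adjacency_core (g : V -> R[i]) (e : R) :
  ell2 g -> ell2 (adjacency G g) -> 0 < e ->
  exists f, [/\ finitely_supported f, (sqnorm (g \- f)%R < (e ^+ 2)%:E)%E &
    (sqnorm (adjacency G g \- adjacency G f)%R < (e ^+ 2)%:E)%E].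
Proof.
move=> gl2 hl2 e0; have Cgt0 := C0; set h := adjacency G g in hl2 *.
have e20 : 0 < e ^+ 2 by exact: exprn_gt0.
(* The tails off K and the tail off F then contribute at most e ^+ 2 / 3 each to
   the final bound. *)
pose d := e ^+ 2 / (9 * (1 + (3 * C) ^+ 2)).
have D1 : 1 <= 1 + (3 * C) ^+ 2 by rewrite lerDl sqr_ge0.
have d0 : 0 < d by rewrite divr_gt0// mulr_gt0//; lra.
pose a (x : V) : R := normc (g x) ^+ 2 + normc (h x) ^+ 2.
have a0 x : 0 <= a x by rewrite addr_ge0// sqr_ge0.
have aoo : (sumV a < +oo)%E.
  rewrite /a (@sumVD _ _ (fun x => normc (g x) ^+ 2) (fun x => normc (h x) ^+ 2)).
  - exact: lte_add_pinfty.
  - by move=> x; exact: sqr_ge0.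
  - by move=> x; exact: sqr_ge0.
have [K aK] := sumV_tail a0 aoo d0.
have gK : (sumV (fun x => off K g x ^+ 2) < d%:E)%E.
  apply: le_lt_trans aK; apply: le_sumV => x; rewrite sqr_off; case: ifP => // _.
  by rewrite lerDl sqr_ge0.
have hK : (sumV (fun x => off K h x ^+ 2) < d%:E)%E.
  apply: le_lt_trans aK; apply: le_sumV => x; rewrite sqr_off; case: ifP => // _.
  by rewrite lerDr sqr_ge0.
pose n := C + \sum_(x <- K) L x.
have Cn : C <= n by rewrite lerDl sumr_ge0// => x _; exact: potential_ge0.
have n0 : 0 < n := lt_le_trans C0 Cn.
have Kn y : y \in K -> L y + C <= n.
  move=> yK; rewrite /n addrC lerD2l (big_fsetD1 y)//= lerDl sumr_ge0// => x _.
  exact: potential_ge0.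
pose B := (2 * (2 * n + C)) ^+ 2.
have B0 : 0 < B by rewrite exprn_gt0// mulr_gt0// addr_gt0// mulr_gt0.
have d'0 : 0 < e ^+ 2 / (9 * B) by rewrite divr_gt0// mulr_gt0.
have [F' gF'] := sumV_tail (fun x => sqr_ge0 (normc (g x))) gl2 d'0.
pose F := (K `|` F')%fset.
have gF : (sumV (fun x => off F g x ^+ 2) < (e ^+ 2 / (9 * B))%:E)%E.
  apply: le_lt_trans gF'; apply: le_sumV => x; rewrite sqr_off inE.
  by case: (x \in F'); rewrite ?orbT//; case: ifP => // _; exact: sqr_ge0.
exists (truncation n F g); split.
- by apply: (@finitely_supported_fset _ _ _ F) => x /negbTE xF; rewrite /truncation xF mul0r.
- apply: (@lt_le_trans _ _ d%:E); last first.
    rewrite lee_fin ler_pdivrMr; last by lra.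
    by rewrite ler_peMr ?ltW//; lra.
  apply: le_lt_trans gK; apply: le_sumV => x /=.
  have -> : g x - truncation n F g x =
      (1 - (if x \in F then cutoff n x else 0))%:C%C * g x.
    by rewrite /truncation rmorphB rmorph1; ring.
  rewrite normcM normc_real ler_sqr ?nnegrE ?mulr_ge0 ?normc_ge0//; last first.
    by rewrite /off; case: ifP => // _; exact: normc_ge0.
  rewrite /off inE; case: (boolP (x \in K)) => [xK|_] /=.
    by rewrite cutoff_eq1 ?subrr ?normr0 ?mul0r//; have := Kn x xK; lra.
  have c0 := cutoff_ge0 n x; have c1 := cutoff_le1 n x.
  by rewrite ler_piMl ?normc_ge0// ger0_norm; case: ifP => _; lra.
- pose S1 x := \sum_(y <- neighbors G x) G x y * `|cutoff n x - cutoff n y| * off K g y.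
  pose S2 x := \sum_(y <- neighbors G x) G x y * (cutoff n x + cutoff n y) * off F g y.
  apply: (@le_lt_trans _ _ (sumV (fun x => (off K h x + S1 x + S2 x) ^+ 2))).
    apply: le_sumV => x /=; have err := @truncation_error n K F g x n0 Kn.
    by rewrite ler_sqr ?nnegrE ?(le_trans _ err)// normc_ge0.
  apply: (le_lt_trans (sumV_sqr3 _ _ _)).
  have s1 := commutator_schur (off K g) Cn; rewrite -/(S1 _) in s1.
  have s2 := truncation_schur (off F g) n0.
  have fin F0 k (c : R) : (sumV (fun x => off F0 k x ^+ 2) < c%:E)%E ->
      exists2 r : R, sumV (fun x => off F0 k x ^+ 2) = r%:E & r < c.
    move=> lt; have [r _ E] := sumV_lt_pinfty_fin (fun x => sqr_ge0 (off F0 k x))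
      (lt_trans lt (ltry _)).
    by exists r => //; rewrite -lte_fin -E.
  have [r1 E1 lt1] := fin _ _ _ gK; have [r2 E2 lt2] := fin _ _ _ hK.
  have [r3 E3 lt3] := fin _ _ _ gF.
  rewrite E1 in s1; rewrite E3 in s2; rewrite E2.
  apply: (@le_lt_trans _ _ (3 * (r2 + (3 * C) ^+ 2 * r1 + B * r3))%:E).
    rewrite EFinM lee_wpmul2l// !EFinD !EFinM.
    by apply: leeD; [exact: leeD|].
  rewrite lte_fin.
  have h1 : (3 * C) ^+ 2 * r1 <= (3 * C) ^+ 2 * d by rewrite ler_wpM2l ?sqr_ge0// ltW.
  have h3 : B * r3 < e ^+ 2 / 9.
    have -> : e ^+ 2 / 9 = B * (e ^+ 2 / (9 * B)) by field; rewrite gt_eqF.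
    by rewrite ltr_pM2l.
  have h2 : d + (3 * C) ^+ 2 * d = e ^+ 2 / 9.
    by rewrite /d; field; rewrite gt_eqF//; lra.
  lra.
Qed.

End Core.

(** * Potentials from degrees and weights *)

Section Variation.
Context {R : realType} {V : countType} (G : wgraph R V).
Hypothesis Gfin : locally_finite G.

Lemma le_max_neighbors x y (F : V -> R) :
  y \in neighbors G x -> F y <= max_neighbors G x F.
Proof. by move=> yx; rewrite /max_neighbors; apply: le_bigmax_seq. Qed.

Lemma max_neighbors_ge0 x (F : V -> R) : 0 <= max_neighbors G x F.
Proof. exact: bigmax_ge_id. Qed.

Lemma sup_variation_edge (h : V -> R) : (sup_variation G h < +oo)%E ->
  exists2 D : R, 0 <= D & forall x y, G x y != 0 -> `|h x - h y| <= D.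
Proof.
move=> hoo; exists (Num.max 0 (fine (sup_variation G h))).
  by rewrite le_max lexx.
move=> x y xy; rewrite le_max; apply/orP; right.
have le1 : (`|h x - h y|%:E <= sup_variation G h)%E.
  apply: (@le_trans _ _ (max_neighbors G x (fun y => `|h x - h y|))%:E).
    rewrite lee_fin; apply: (le_max_neighbors (fun y => `|h x - h y|)).
    by rewrite in_neighbors.
  by apply: ereal_sup_ubound; exists x.
by move: hoo le1; case: (sup_variation G h).
Qed.

Lemma row_sum_le x (m : R) : (forall y, y \in neighbors G x -> G x y <= m) ->
  \sum_(y <- neighbors G x) G x y <= (degree G x)%:R * m.
Proof.
move=> Gm; rewrite big_seq.
apply: (@le_trans _ _ (\sum_(y <- neighbors G x | y \in neighbors G x) m)).
  exact: ler_sum.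
by rewrite -big_seq big_const_seq count_predT iter_addr_0 mulr_natl.
Qed.

End Variation.

Theorem proposition1p1 (R : realType) (V : countType) (G : wgraph R V)
  (Gfin : locally_finite G)
  (Gdeg : (sup_variation G (fun x => (degree G x)%:R) < +oo)%E)
  (Gwgt : (sup_variation G (max_weight G) < +oo)%E)
  (Gbnd : (exists M : nat, forall x : V, (degree G x <= M)%N) \/
          (exists M : R, forall x y : V, G x y <= M)) :
  essentially_self_adjoint (adjacency_op G).
Proof.
suff [L [C [C0 Lrow Llip]]] : exists (L : V -> R) (C : R), [/\ 0 < C,
    forall x, \sum_(y <- neighbors G x) G x y <= L x &
    forall x y, G x y != 0 -> `|L x - L y| <= C].
  apply: essentially_self_adjoint_of_core => // g e.
  exact: (adjacency_core Gfin C0 Lrow Llip).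
case: Gbnd => [[M dM]|[M GM]].
- have [D D0 DP] := sup_variation_edge Gfin Gwgt.
  exists (fun x => M%:R * max_weight G x), (M%:R * D + 1); split.
  + by rewrite ltr_wpDl// mulr_ge0.
  + move=> x; apply: (@le_trans _ _ ((degree G x)%:R * max_weight G x)).
      by apply: row_sum_le => y; exact: le_max_neighbors.
    by rewrite ler_wpM2r ?max_neighbors_ge0// ler_nat.
  + move=> x y xy; rewrite -mulrBr normrM ger0_norm//.
    by rewrite ler_wpDr// ler_wpM2l// DP.
- have [D D0 DP] := sup_variation_edge Gfin Gdeg.
  have m0 : 0 <= Num.max 0 M by rewrite le_max lexx.
  exists (fun x => (degree G x)%:R * Num.max 0 M), (D * Num.max 0 M + 1); split.
  + by rewrite ltr_wpDl// mulr_ge0.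
  + by move=> x; apply: row_sum_le => y _; rewrite le_max GM orbT.
  + move=> x y xy; rewrite -mulrBl normrM (ger0_norm m0).
    by rewrite ler_wpDr// ler_wpM2r// DP.
Qed.
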